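(* Let $\Delta>0$, let $n\geq 1$ be an integer, and let $\beta^{n}$ be the B-spline of order $n$. If $(c_m)_{m\in\mathbb{Z}}$ is a real sequence such that $0\leq c_m-c_{m-1}\leq\Delta$ for all $m\in\mathbb{Z}$, then the function $f:\mathbb{R}\to\mathbb{R}$ defined by $$f(x)=\sum_{m\in\mathbb{Z}}c_m\,\beta^{n}\left(\frac{x}{\Delta}-m\right)$$ is firmly nonexpansive.
   Context: The B-splines $\beta^n:\mathbb{R}\to\mathbb{R}$ of integer order $n\geq 0$ are defined recursively by $\beta^0(x)=1$ if $|x|\leq 1/2$ and $\beta^0(x)=0$ if $|x|>1/2$, and $\beta^{n}=\beta^{n-1}*\beta^{0}$ (convolution on $\mathbb{R}$) for $n\geq 1$. They are compactly supported, so the sum defining $f(x)$ has finitely many nonzero terms for each $x$. A function $f:\mathbb{R}\to\mathbb{R}$ is firmly nonexpansive if $(x-y)(f(x)-f(y))\geq (f(x)-f(y))^2$ for all $x,y\in\mathbb{R}$. *)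

(* Defs.v *)
From mathcomp Require Import all_boot all_order all_algebra.
From mathcomp Require Import all_classical all_reals all_analysis.

Set Implicit Arguments.
Unset Strict Implicit.
Unset Printing Implicit Defensive.

Import Order.TTheory GRing.Theory Num.Theory.

Local Open Scope classical_set_scope.
Local Open Scope ring_scope.

(* The integral is total: where the integrand is not integrable, the value of
   the convolution carries no meaning. Below, the arguments are bounded,
   measurable and compactly supported. *)
Definition convolution (R : realType) (f g : R -> R) (x : R) : R :=
  \int[@lebesgue_measure R]_y (f y * g (x - y)).

Definition bspline0 (R : realType) (x : R) : R :=
  if `|x| <= 2^-1 then 1 else 0.

Fixpoint bspline (R : realType) (n : nat) : R -> R :=
  match n with
  | 0 => @bspline0 R
  | n'.+1 => convolution (bspline n') (@bspline0 R)
  end.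

Definition firmly_nonexpansive (R : realType) (f : R -> R) : Prop :=
  forall x y : R, (x - y) * (f x - f y) >= (f x - f y) ^+ 2.

(* The sum over int ranges over the m whose term is nonzero, finitely many since
   bspline n is compactly supported. (With infinitely many nonzero terms the
   operator would return 0.) *)
Definition spline (R : realType) (n : nat) (Delta : R) (c : int -> R) (x : R)
    : R :=
  \sum_(m \in [set: int]) (c m * bspline n (x / Delta - m%:~R)).

(* Main.v *)
(* A nondecreasing 1-Lipschitz function is firmly nonexpansive, and rescaling
   by Delta reduces that to 0 <= S_n t - S_n s <= Delta * (t - s) for s <= t,
   where S_n t = sum_m c_m beta^n (t - m). For n = 1, beta^1 is the hat function,
   so S_1 interpolates the c_m linearly. Since (beta^(n+1))'(t) =
   beta^n (t + 1/2) - beta^n (t - 1/2), we get S_(n+1)' t =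
   S_n (t + 1/2) - S_n (t - 1/2), which lies in [0, Delta] by the bound for S_n. *)
Require Import Defs.
From mathcomp Require Import all_boot all_order all_algebra.
From mathcomp Require Import all_classical all_reals all_analysis.
From mathcomp Require Import zify ring lra.

Import Order.TTheory GRing.Theory Num.Theory.
Import numFieldNormedType.Exports.

Local Open Scope classical_set_scope.
Local Open Scope ring_scope.

(** As a function of [y], [bspline0 (x - y)] is the indicator of the closed unit window centred at
    [x]. *)
Lemma convolution_bspline0 (R : realType) (f : R -> R) (x : R) :
  convolution f (@bspline0 R) x =
  \int[@lebesgue_measure R]_(y in `[x - 2^-1, x + 2^-1]) f y.
Proof.
rewrite Rintegral_mkcond /convolution; apply: eq_Rintegral => y _.
rewrite /bspline0 patchE mem_setE in_itv /= ler_distlC.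
by case: ifP; rewrite ?mulr1 ?mulr0.
Qed.

(** The value is the length of the overlap of two unit intervals, centred at [x] and at 0. *)
Lemma bspline1E (R : realType) (x : R) : bspline 1 x = Num.max 0 (1 - `|x|).
Proof.
rewrite /= convolution_bspline0.
have -> : @bspline0 R = (cst 1 : R -> R) \_ `[- 2^-1, 2^-1].
  apply/funext => y.
  by rewrite /bspline0 patchE mem_setE in_itv /= -ler_norml.
rewrite -Rintegral_mkcondr Rintegral_cst; last first.
  by apply: measurableI; exact: measurable_itv.
have -> : `[x - 2^-1, x + 2^-1] `&` `[- 2^-1, 2^-1] =
    `[Num.max (x - 2^-1) (- 2^-1), Num.min (x + 2^-1) 2^-1]%classic.
  apply/seteqP; split => y /=; rewrite !in_itv /= ge_max le_min.
    by move=> [/andP[-> ->] /andP[-> ->]].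
  by move=> /andP[/andP[-> ->] /andP[-> ->]].
rewrite mul1r /= lebesgue_measure_itv /= lte_fin.
have [x0|x0] := leP 0 x.
  rewrite (@max_l _ _ (x - _)) ?(@min_r _ _ (x + _)) ?ger0_norm //; [|lra..].
  by case: ltP => /= h; [rewrite max_r; lra|rewrite max_l //; lra].
rewrite (@max_r _ _ (x - _)) ?(@min_l _ _ (x + _)) ?ltr0_norm //; [|lra..].
by case: ltP => /= h; [rewrite max_r; lra|rewrite max_l //; lra].
Qed.

Lemma is_derive_comp_shift (R : realType) (f : R -> R) (k x df : R) :
  is_derive (x + k) 1 f df -> is_derive x 1 (fun y => f (y + k)) df.
Proof.
move=> fdf; rewrite -[df]mulr1.
exact: (@is_derive1_comp R f (shift k) x df 1 fdf (is_derive_shift x 1 k)).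
Qed.

Lemma is_derive_convolution_bspline0 (R : realType) (f : R -> R) (x : R) :
  continuous f ->
  is_derive x 1 (convolution f (@bspline0 R)) (f (x + 2^-1) - f (x - 2^-1)).
Proof.
move=> cf.
(* A base point independent of the window: [x - 2] lies to the left of [y - 1/2] for every [y]
   within 1 of [x], so near [x] the convolution is [F (y + 1/2) - F (y - 1/2)]. *)
pose F z := \int[@lebesgue_measure R]_(y in `[x - 2, z]) f y.
have intf a b : (@lebesgue_measure R).-integrable `[a, b] (EFin \o f).
  apply: continuous_compact_integrable; first exact: segment_compact.
  exact: continuous_subspaceT.
have dF (z : R) : x - 2 < z -> is_derive z 1 F (f z).
  move=> xz; have zz : z < z + 1 by lra.
  have [dF F'] := @continuous_FTC1_closed R f (x - 2) z _ zz (intf _ _) xz (cf z).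
  by apply: (DeriveDef dF); rewrite -F' derive1E.
have dFs e : `|e| <= 1 -> is_derive x 1 (F \o shift e) (f (x + e)).
  move=> e1; apply: is_derive_comp_shift.
  by apply: dF; move: e1; rewrite ler_norml => /andP[]; lra.
have dG := is_deriveB (dFs 2^-1 ltac:(rewrite ger0_norm; lra))
  (dFs (- 2^-1) ltac:(rewrite normrN ger0_norm; lra)).
apply: (near_eq_is_derive _ dG).
near=> y.
have xy : `|x - y| < 1 by near: y; exact: nbhsx_ballx.
have {}xy : x - 1 < y by move: xy; rewrite ltr_distlC => /andP[].
rewrite convolution_bspline0 fctE /= /F Rintegral_itvB.
- rewrite Rintegral_itv_obnd_cbnd //.
  by apply: integrableS (intf (y - 2^-1) (y + 2^-1)) => //; exact: subset_itv_oc_cc.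
- exact: intf.
- by rewrite bnd_simp; lra.
- by rewrite bnd_simp; lra.
Unshelve. all: by end_near.
Qed.

(** Order 0 is excluded because [bspline0] jumps; from order 2 on, continuity follows from
    differentiability. *)
Lemma bspline_continuous (R : realType) (n : nat) : continuous (@bspline R n.+1).
Proof.
elim: n => [|n IHn] x.
  rewrite (_ : bspline 1 = (cst 0 : R -> R) \max (fun y => 1 - `|y|)); last first.
    by apply/funext => y; exact: bspline1E.
  apply: continuous_max; first exact: cvg_cst.
  by apply: cvgB; [exact: cvg_cst|exact: norm_continuous].
apply/differentiable_continuous/derivable1_diffP.
by have [] := @is_derive_convolution_bspline0 R (bspline n.+1) x IHn.
Qed.

Lemma is_derive_bspline (R : realType) (n : nat) (x : R) :
  is_derive x 1 (bspline n.+2) (bspline n.+1 (x + 2^-1) - bspline n.+1 (x - 2^-1)).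
Proof.
exact: (is_derive_convolution_bspline0 _ (bspline n.+1) x (@bspline_continuous R n)).
Qed.

(** Each convolution widens the support by 1/2 on either side; the cruder radius [n + 1] is enough
    to make the sums finite. *)
Lemma bspline_eq0 (R : realType) (n : nat) (x : R) : n.+1%:R < `|x| -> bspline n x = 0.
Proof.
elim: n x => [|n IHn] x nx.
  by rewrite /= /bspline0 ifF //; apply/negbTE; rewrite -ltNge; lra.
rewrite /= convolution_bspline0 /Rintegral integral0_eq //= => y.
rewrite in_itv /= -ler_distlC => xy.
congr EFin; apply: IHn; have := lerB_dist x y.
move: nx; rewrite -addn1 natrD; lra.
Qed.

Definition cardinal_spline {R : realType} (n : nat) (c : int -> R) (t : R) : R :=
  \sum_(m \in [set: int]) (c m * bspline n (t - m%:~R)).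

(** One index list serves all bounded [t] and all orders up to [n], so that a spline can be
    differentiated term by term and its derivative regrouped over the same list. *)
Lemma cardinal_spline_seq (R : realType) (n : nat) (B : R) :
  exists r : seq int, forall (k : nat) (c : int -> R) (t : R),
    (k <= n)%N -> `|t| <= B ->
    cardinal_spline k c t = \sum_(m <- r) c m * bspline k (t - m%:~R).
Proof.
(* If [|m| > N] and [|t| <= B], then [|t - m| > n + 1], outside every support; [r] lists the
   integers from [-N] to [N]. *)
pose N := Num.bound `|B + n.+1%:R|.
pose r := [seq (i%:Z - N%:Z) | i <- iota 0 (N + N).+1].
exists r => k c t kn tB.
rewrite /cardinal_spline (@fsbigE _ _ _ _ _ r) //.
- by apply: eq_bigl => m; rewrite in_setT.
- by rewrite map_inj_uniq ?iota_uniq // => i j; lia.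
- move=> m _ /mapP mN; rewrite bspline_eq0 ?mulr0 //.
  have Nm : (N%:Z < `|m|)%R.
    rewrite ltNge; apply/negP => mleN; apply: mN; exists (absz (m + N%:Z)); last lia.
    by rewrite mem_iota; lia.
  have {}Nm : N%:R < `|m%:~R : R|.
    by rewrite -intr_norm -(ltr_int R) in Nm *.
  have BN : B + n.+1%:R < N%:R.
    exact: le_lt_trans (ler_norm _) (archi_boundP (normr_ge0 _)).
  have : k.+1%:R <= n.+1%:R :> R by rewrite ler_nat.
  have := lerB_dist (m%:~R) t; rewrite distrC; lra.
Qed.

Lemma cardinal_spline1E (R : realType) (c : int -> R) (m : int) (t : R) :
  m%:~R <= t <= (m + 1)%:~R ->
  cardinal_spline 1 c t = c m + (c (m + 1) - c m) * (t - m%:~R).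
Proof.
rewrite intrD => /andP[mt tm].
rewrite /cardinal_spline (@fsbigE _ _ _ _ _ [:: m; m + 1]) //; last 2 first.
- by rewrite /= inE andbT; apply/eqP; lia.
- move=> k _; rewrite !inE negb_or => /andP[km km1].
  rewrite bspline1E.
  (* Any other integer [k] is at distance at least 1 from [t], where the hat function vanishes. *)
  have [kltm|mltk] : (k + 1 <= m \/ m + 2 <= k)%R by lia.
    have {}kltm : (k + 1)%:~R <= m%:~R :> R by rewrite ler_int.
    rewrite intrD in kltm; rewrite max_l ?mulr0 // ger0_norm; lra.
  have {}mltk : (m + 2)%:~R <= k%:~R :> R by rewrite ler_int.
  rewrite intrD in mltk; rewrite max_l ?mulr0 // ler0_norm; lra.
rewrite !big_cons big_nil !in_setT !bspline1E intrD /=.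
rewrite ger0_norm ?ler0_norm; [|lra..].
by rewrite !max_r; [ring|lra..].
Qed.

Definition monotone_lipschitz {R : realType} (D : R) (f : R -> R) : Prop :=
  forall s t : R, s <= t -> 0 <= f t - f s <= D * (t - s).

Lemma cardinal_spline1_monotone_lipschitz (R : realType) (D : R) (c : int -> R) :
  (forall m : int, 0 <= c m - c (m - 1) <= D) ->
  monotone_lipschitz D (cardinal_spline 1 c).
Proof.
move=> c_incr s t st.
have cD (m : int) (k : nat) : 0 <= c (m + k%:Z) - c m <= D * k%:R.
  elim: k => [|k IHk]; first by rewrite addr0 subrr mulr0 lexx.
  have := c_incr (m + k.+1%:Z); rewrite -addrA.
  have -> : k.+1%:Z - 1 = k%:Z by lia.
  by rewrite -natr1 mulrDr; lra.
have c1 (m : int) : 0 <= c (m + 1) - c m <= D.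
  by have := c_incr (m + 1); rewrite addrK.
have fl (u : R) : (Num.floor u)%:~R <= u <= (Num.floor u + 1)%:~R.
  by rewrite floor_le /= ltW // floorD1_gt.
have := fl s; have := fl t.
rewrite !(cardinal_spline1E _ _ _ _ (fl _)).
set k := Num.floor s; set m := Num.floor t.
have : k <= m by exact: le_floor.
rewrite !intrD.
rewrite le_eqVlt => /predU1P[<-|km].
  have := c1 k; nra.
(* The increment splits at [k + 1] and [m] into the rest of the cell of [s], [j] full cells and the
   start of the cell of [t]; [c1] bounds the outer pieces and [cD] the middle one. *)
have [j mE] : exists j : nat, m = k + 1 + j%:Z by exists (absz (m - (k + 1))%R); lia.
have := cD (k + 1) j; rewrite -mE.
have := c1 k; have := c1 m.
have -> : m%:~R = k%:~R + 1 + j%:R :> R by rewrite mE !intrD.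
nra.
Qed.

Lemma is_derive_sum_seq (R : realType) (I : Type) (r : seq I) (f : I -> R -> R)
    (df : I -> R) (x : R) :
  (forall i, is_derive x 1 (f i) (df i)) ->
  is_derive x 1 (fun y => \sum_(i <- r) f i y) (\sum_(i <- r) df i).
Proof.
move=> fdf; rewrite (_ : (fun y => _) = \sum_(i <- r) f i); last first.
  by apply/funext => y; rewrite fct_sumE.
by elim/big_ind2 : _ => // [|] *; [exact: is_derive_cst|exact: is_deriveD].
Qed.

Lemma cardinal_splineS_monotone_lipschitz (R : realType) (D : R) (c : int -> R)
    (n : nat) :
  monotone_lipschitz D (cardinal_spline n.+1 c) ->
  monotone_lipschitz D (cardinal_spline n.+2 c).
Proof.
move=> mlD s t st.
(* The extra 1 leaves room for the shifts by 1/2 of points between [s] and [t]. *)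
pose B := `|s| + `|t| + 1.
have [r rE] := @cardinal_spline_seq R n.+2 B.
pose F (u : R) := \sum_(m <- r) c m * bspline n.+2 (u - m%:~R).
pose dF (u : R) := cardinal_spline n.+1 c (u + 2^-1) - cardinal_spline n.+1 c (u - 2^-1).
have s0 := normr_ge0 s; have t0 := normr_ge0 t.
have FE u : `|u| <= B - 1 -> cardinal_spline n.+2 c u = F u.
  by move=> uB; apply: rE => //; lra.
have dFE (u : R) : s <= u <= t -> is_derive u 1 F (dF u).
  move=> sut.
  have uB : - (B - 1) <= u <= B - 1.
    have := ler_norm t; have := ler_norm (- s); rewrite normrN /B; lra.
  rewrite /dF !rE //; [|by rewrite ler_norml; lra..].
  rewrite -sumrB; apply: is_derive_sum_seq => m; rewrite -mulrBr.
  apply: is_deriveZ; apply: is_derive_comp_shift.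
  rewrite (addrAC u 2^-1) (addrAC u (- 2^-1)); exact: is_derive_bspline.
rewrite !FE; [|rewrite /B; lra..].
have [||u ust ->] := @MVT_segment R F dF s t st.
- by move=> u; rewrite in_itv /= => ust; apply: dFE; lra.
- apply: derivable_within_continuous => u; rewrite in_itv /= => ust.
  by have [] := dFE u ust.
(* The two arguments differ by 1, so the bound for the lower order puts the derivative in
   [[0, D]]. *)
have := mlD (u - 2^-1) (u + 2^-1) ltac:(lra).
rewrite -/(dF u) => dFu; have : 0 <= dF u <= D by lra.
by move=> {}dFu; nra.
Qed.

Theorem theorem4 (R : realType) (Delta : R) (n : nat) (c : int -> R)
  (Delta_gt0 : 0 < Delta) (n_ge1 : (1 <= n)%N)
  (c_incr : forall m : int, 0 <= c m - c (m - 1) <= Delta) :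
  firmly_nonexpansive (spline n Delta c).
Proof.
have mlD : monotone_lipschitz Delta (cardinal_spline n c).
  case: n n_ge1 => // n _; elim: n => [|n IHn].
    exact: cardinal_spline1_monotone_lipschitz.
  exact: cardinal_splineS_monotone_lipschitz.
have fxy (x y : R) : y <= x ->
    0 <= spline n Delta c x - spline n Delta c y <= x - y.
  move=> yx; have := mlD (y / Delta) (x / Delta).
  rewrite ler_pM2r ?invr_gt0 // => /(_ yx).
  by rewrite -mulrBl mulrCA divff ?mulr1 ?gt_eqF.
(* With [d = f x - f y] and [0 <= d <= x - y], multiplying by [d] gives the claim, which is
   symmetric in [x] and [y]. *)
move=> x y; have [/fxy|/ltW /fxy] := leP y x; nra.
Qed.
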